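(* Let $A_\mu\in\mathbb{R}^{n\times n}$ be symmetric positive definite, let $\Omega\in\mathbb{R}^{n\times l}$ be nonzero with $l<n$, and let $\Pi$ be the orthogonal projector onto $\mathrm{range}(A_\mu\Omega)$. Let $$P=(I-\Pi)+\tau\,\Pi A_\mu^{-1}\Pi ,$$ and denote $E=(I-\Pi)A_\mu(I-\Pi)$ and $F=(I-\Pi)A_\mu^{-1}(I-\Pi)$. Let $\rho>0$. If $$\tau=\rho\,\|E\|\,\lambda_{\max}^{-1}(\Pi A_\mu\Pi A_\mu^{-1}\Pi),$$ then all eigenvalues of the preconditioned operator $P^{1/2}A_\mu P^{1/2}$ satisfy $$(\|F\|+\tau^{-1})^{-1}\le\lambda_i(P^{1/2}A_\mu P^{1/2})\le(1+\rho)\|E\| .$$ In particular, $$\mathrm{cond}(P^{1/2}A_\mu P^{1/2})\le(1+\rho)\frac{\|E\|}{\lambda_{\min}(A_\mu)}+(1+\rho^{-1})\lambda_{\max}(\Pi A_\mu\Pi A_\mu^{-1}\Pi)\le(1+\rho)\frac{\|E\|}{\lambda_{\min}(A_\mu)}+(1+\rho^{-1})\left(1+\frac{\|E\|^{1/2}}{\lambda_{\min}(A_\mu)^{1/2}}\right)^2 .$$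
   Context: $\|\cdot\|$ is the spectral norm; $\lambda_{\max},\lambda_{\min}$ are the largest and smallest eigenvalues (the matrix $\Pi A_\mu\Pi A_\mu^{-1}\Pi$ has real nonnegative eigenvalues); $\mathrm{cond}(B)$ is the ratio of the largest to the smallest singular value of $B$. In the paper $A_\mu=A+\mu I$ with $\mu\in\mathbb R$. *)

(* Defs.v *)
From HB Require Import structures.
From mathcomp Require Export all_boot all_order all_algebra.
From mathcomp Require Export boolp classical_sets reals.

Set Implicit Arguments.
Unset Strict Implicit.
Unset Printing Implicit Defensive.

Import Order.TTheory GRing.Theory Num.Theory.

Local Open Scope classical_set_scope.
Local Open Scope ring_scope.

Definition euclid_norm (R : realType) (n : nat) (x : 'cV[R]_n) : R :=
  Num.sqrt (\sum_(i < n) x i 0 ^+ 2).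

(* The sup is over a bounded set, nonempty as soon as n > 0. *)
Definition spectral_norm (R : realType) (n : nat) (B : 'M[R]_n) : R :=
  sup [set euclid_norm (B *m x) | x in [set x : 'cV[R]_n | euclid_norm x = 1]].

(* Extremal real eigenvalues, meaningful for matrices whose eigenvalues are all
   real.  The set of eigenvalues is finite, so that sup and inf are attained
   when it is nonempty; the values are 0 by convention when it is empty.
   [eigenvalue] is about row (left) eigenvectors, which yield the same
   eigenvalues as column ones. *)
Definition lambda_max (R : realType) (n : nat) (B : 'M[R]_n) : R :=
  sup [set a | eigenvalue B a].

Definition lambda_min (R : realType) (n : nat) (B : 'M[R]_n) : R :=
  inf [set a | eigenvalue B a].

Definition singular_value (R : realType) (n : nat) (B : 'M[R]_n) : set R :=
  [set s | 0 <= s /\ eigenvalue (B^T *m B) (s ^+ 2)].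

Definition cond (R : realType) (n : nat) (B : 'M[R]_n) : R :=
  sup (singular_value B) / inf (singular_value B).

Definition sympsd (R : realType) (n : nat) (B : 'M[R]_n) : Prop :=
  B^T = B /\ forall x : 'cV[R]_n, 0 <= (x^T *m B *m x) 0 0.

Definition sympd (R : realType) (n : nat) (B : 'M[R]_n) : Prop :=
  B^T = B /\ forall x : 'cV[R]_n, x != 0 -> 0 < (x^T *m B *m x) 0 0.

(* The symmetric positive semidefinite square root, unique when it exists
   (i.e. when B is symmetric positive semidefinite); 0 otherwise. *)
Definition sqrtmx (R : realType) (n : nat) (B : 'M[R]_n) : 'M[R]_n :=
  xget 0 [set S : 'M[R]_n | sympsd S /\ S *m S = B].

(* The range of a matrix is its column space, and [:=:] compares row spaces,
   hence the transposes. *)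
Definition orthogonal_projector_onto_range (R : realType) (n l : nat)
    (Pi : 'M[R]_n) (M : 'M[R]_(n, l)) : Prop :=
  [/\ Pi^T = Pi, Pi *m Pi = Pi & (Pi^T :=: M^T)%MS].

(* Main.v *)
(* With [H = Pi A^-1 Pi], an eigenvector of [P^(1/2) A P^(1/2)] for [a] yields a
   nonzero [y] with [y^T P y = a (y^T A^-1 y)], where
   [y^T P y = |Pc y|^2 + tau (y^T H y)].  The upper bound on [a] adds
   [|Pc y|^2 <= ||E|| y^T A^-1 y] (Cauchy-Schwarz for [A]) and
   [y^T H y <= lambda_max G (y^T A^-1 y)]; the lower one is the triangle
   inequality for the norm of [A^-1] in [y = Pc y + Pi y].  Likewise a positive
   eigenvalue of [G] is [a = |Pi y|^2 / |y|^2] for the norm of [A^-1], and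
   [|Pi y| <= |y| + |Pc y|].
   The underlying spectral theorem is obtained without eigenbases: a real
   symmetric matrix has a split characteristic polynomial and is annihilated by
   the product of its distinct linear factors, since a nilpotent symmetric
   matrix is zero; polynomial identities on the spectrum thus hold for the
   matrix. *)
Require Import Defs.
From mathcomp Require Import all_boot all_order all_algebra polyrcf complex.
From mathcomp Require Import boolp classical_sets reals.
From mathcomp Require Import ring lra.

Import Order.TTheory GRing.Theory Num.Theory.

Local Open Scope ring_scope.

(** * Quadratic forms *)

Section QuadraticForms.
Context {R : realType} {n : nat}.
Implicit Types (M K : 'M[R]_n) (x y z : 'cV[R]_n).

Definition bform M x y : R := (x^T *m M *m y) 0 0.

Lemma bformDl M x y z : bform M (x + y) z = bform M x z + bform M y z.
Proof. by rewrite /bform linearD !mulmxDl mxE. Qed.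

Lemma bformDr M x y z : bform M x (y + z) = bform M x y + bform M x z.
Proof. by rewrite /bform mulmxDr mxE. Qed.

Lemma bformZl M a x y : bform M (a *: x) y = a * bform M x y.
Proof. by rewrite /bform linearZ -!scalemxAl mxE. Qed.

Lemma bformZr M a x y : bform M x (a *: y) = a * bform M x y.
Proof. by rewrite /bform -scalemxAr mxE. Qed.

Lemma bformC {M} x y : M^T = M -> bform M x y = bform M y x.
Proof.
move=> sM; rewrite /bform; transitivity ((x^T *m M *m y)^T 0 0); first by rewrite [RHS]mxE.
by rewrite !trmx_mul trmxK sM mulmxA.
Qed.

Lemma bform_mull M K x y : bform M (K *m x) y = bform (K^T *m M) x y.
Proof. by rewrite /bform trmx_mul !mulmxA. Qed.

Lemma bform_mulr M K x y : bform M x (K *m y) = bform (M *m K) x y.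
Proof. by rewrite /bform !mulmxA. Qed.

Lemma bform_symconj {K} M x : K^T = K ->
  bform (K *m M *m K) x x = bform M (K *m x) (K *m x).
Proof. by move=> sK; rewrite bform_mull bform_mulr sK. Qed.

Lemma bformDm M K x y : bform (M + K) x y = bform M x y + bform K x y.
Proof. by rewrite /bform mulmxDr mulmxDl mxE. Qed.

Lemma bformZm a M x y : bform (a *: M) x y = a * bform M x y.
Proof. by rewrite /bform -scalemxAr -scalemxAl mxE. Qed.

Lemma bform1E x : bform 1%:M x x = \sum_(i < n) x i 0 ^+ 2.
Proof. by rewrite /bform mulmx1 mxE; apply: eq_bigr => i _; rewrite mxE expr2. Qed.

Lemma bform1_ge0 x : 0 <= bform 1%:M x x.
Proof. by rewrite bform1E sumr_ge0 // => i _; apply: sqr_ge0. Qed.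

Lemma bform1_eq0 x : bform 1%:M x x = 0 -> x = 0.
Proof.
rewrite bform1E => /eqP; rewrite psumr_eq0 => [/allP x0|i _]; last exact: sqr_ge0.
apply/matrixP => i j; rewrite (ord1 j) mxE; apply/eqP.
by rewrite -sqrf_eq0; apply: x0; rewrite mem_index_enum.
Qed.

Lemma bform1_gt0 x : x != 0 -> 0 < bform 1%:M x x.
Proof.
by move=> x0; rewrite lt_def bform1_ge0 andbT; apply: contra_neq x0; apply: bform1_eq0.
Qed.

Lemma euclid_normE x : euclid_norm x = Num.sqrt (bform 1%:M x x).
Proof. by rewrite bform1E. Qed.

Lemma sympsd_bform_ge0 {M} x : sympsd M -> 0 <= bform M x x.
Proof. by case=> _; apply. Qed.

Lemma sympd_bform_gt0 {M} x : sympd M -> x != 0 -> 0 < bform M x x.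
Proof. by case=> _; apply. Qed.

Lemma sympd_sympsd {M} : sympd M -> sympsd M.
Proof.
case=> sM pM; split=> // x; have [->|/pM/ltW//] := eqVneq x 0.
by rewrite mulmx0 mxE.
Qed.

Lemma sympsd1 : sympsd (1%:M : 'M[R]_n).
Proof. by split; [exact: trmx1 | exact: bform1_ge0]. Qed.

Lemma sympsd_conj {m} M (K : 'M[R]_(n, m)) : sympsd M -> sympsd (K^T *m M *m K).
Proof.
move=> [sM pM]; split; first by rewrite !trmx_mul trmxK sM mulmxA.
by move=> x; have := pM (K *m x); rewrite trmx_mul !mulmxA.
Qed.

(** Nonnegativity of the form at [a *: x + b *: y], with [a] and [b] well chosen. *)
Lemma bform_CauchySchwarz {M} x y : sympsd M ->
  bform M x y ^+ 2 <= bform M x x * bform M y y.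
Proof.
move=> pM; have /= := pM; case=> sM _.
have E a b : 0 <= a ^+ 2 * bform M x x + 2 * a * b * bform M x y + b ^+ 2 * bform M y y.
  have := sympsd_bform_ge0 (a *: x + b *: y) pM.
  rewrite !(bformDl, bformDr, bformZl, bformZr) (bformC y x sM).
  by congr (_ <= _); ring.
have px := sympsd_bform_ge0 x pM; have py := sympsd_bform_ge0 y pM.
have [y0|y0] := eqVneq (bform M y y) 0.
  rewrite y0 mulr0.
  (* These coefficients turn [E] into [0 <= - (bform M x y)^2 (bform M x x + 2)], which forces
     [bform M x y = 0]. *)
  have := E (bform M x y) (- (bform M x x + 1)); rewrite y0; nra.
have {}py : 0 < bform M y y by rewrite lt_def y0.
(* These coefficients minimise the form up to scaling: [E] becomes the claim multiplied by
   [bform M y y > 0]. *)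
have := E (bform M y y) (- bform M x y); nra.
Qed.

End QuadraticForms.

Lemma sympd_unitmx {R : realType} {n} {M : 'M[R]_n} : sympd M -> M \in unitmx.
Proof.
move=> pM; rewrite -unitmx_tr -row_free_unit; apply: inj_row_free => v vM.
apply/eqP/negPn/negP => v0; have := sympd_bform_gt0 v^T pM.
rewrite trmx_eq0 v0 => /(_ isT).
by rewrite /bform trmxK -[M](proj1 pM) vM mul0mx mxE ltxx.
Qed.

(** * Real symmetric matrices *)

(** With [w] the conjugate of the eigenvector [v], evaluating [v K w^T] from either side gives [z s]
    and [z^* s], where [s = v w^T] is the nonzero squared norm of [v]. *)
Lemma symmx_eigenvalue_real {R : rcfType} {n} (K : 'M[R]_n) (z : R[i]) :
  K^T = K -> eigenvalue (map_mx (real_complex R) K) z -> complex.Im z = 0.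
Proof.
move=> sK /eigenvalueP[v vK v0]; set KC := map_mx _ K in vK.
have sKC : KC^T = KC by rewrite /KC map_trmx sK.
have cKC : map_mx (@conjc R) KC = KC.
  by apply/matrixP => i j; rewrite !mxE conjc_real.
set w := map_mx (@conjc R) v.
have wK : w *m KC = z^*%C *: w by rewrite -[KC]cKC -map_mxM vK map_mxZ.
pose s := (v *m w^T) 0 0.
have s0 : s != 0.
  rewrite /s mxE; under eq_bigr do rewrite !mxE.
  rewrite psumr_eq0 => [|i _]; last exact: mulcJ_ge0.
  apply: contra_neqN v0 => /allP v0; apply/rowP => i; rewrite mxE.
  have /v0 /= := mem_index_enum i.
  by rewrite mulf_eq0 conjc_eq0 orbb => /eqP.
have : z * s = z^*%C * s.
  transitivity ((v *m KC *m w^T) 0 0); first by rewrite vK -scalemxAl mxE.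
  by rewrite -mulmxA -[KC]sKC -trmx_mul wK linearZ -scalemxAr mxE.
move/(mulIf s0); case: z {vK wK} => a b /= [] /eqP.
by rewrite -addr_eq0 -mulr2n mulrn_eq0 /= => /eqP.
Qed.

Lemma symmx_char_poly_split {R : rcfType} {n} (K : 'M[R]_n) :
  K^T = K -> {s : seq R | char_poly K = \prod_(a <- s) ('X - a%:P)}.
Proof.
move=> sK; have [r] := closed_field_poly_normal (char_poly (map_mx (real_complex R) K)).
rewrite (monicP (char_poly_monic _)) scale1r => rE.
exists (map (@complex.Re R) r); apply: (map_poly_inj (real_complex R)).
rewrite map_char_poly rE rmorph_prod big_map [LHS]big_seq [RHS]big_seq.
apply: eq_bigr => z zr; rewrite rmorphB /= map_polyX map_polyC /=.
suff -> : (complex.Re z)%:C%C = z by [].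
have /(symmx_eigenvalue_real _ _ sK) : eigenvalue (map_mx (real_complex R) K) z.
  by rewrite eigenvalue_root_char rE root_prod_XsubC.
by case: z {zr} => a b /= ->.
Qed.

Lemma symmx_horner {R : comNzRingType} {n} (K : 'M[R]_n.+1) (p : {poly R}) :
  K^T = K -> (horner_mx K p)^T = horner_mx K p.
Proof.
move=> sK; elim/poly_ind: p => [|p c IHp]; first by rewrite rmorph0 trmx0.
rewrite rmorphD rmorphM /= horner_mx_X horner_mx_C linearD /= tr_scalar_mx.
rewrite trmx_mul sK IHp; congr (_ + _).
have : horner_mx K ('X * p) = horner_mx K (p * 'X) by rewrite mulrC.
by rewrite !rmorphM /= horner_mx_X.
Qed.

(** Once enlarged to a power of two, the exponent can be halved repeatedly: a symmetric [T] with
    [T T = 0] satisfies [|T x|^2 = x^T T T x = 0] for every [x]. *)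
Lemma symmx_expn_eq0 {R : realType} {n} (K : 'M[R]_n.+1) k :
  K^T = K -> K ^+ k = 0 -> K = 0.
Proof.
move=> sK Kk0; suff pow2 j : K ^+ (2 ^ j) = 0 -> K = 0.
  by apply: (pow2 k); rewrite -(subnK (ltnW (ltn_expl k (ltnSn 1)))) exprD Kk0 mulr0.
elim: j => [|j IHj]; rewrite ?expr1// expnS mulnC exprM expr2 => KK0.
apply: IHj; set T := K ^+ _ in KK0 *.
have sT : T^T = T.
  by rewrite /T -[K]horner_mx_X -rmorphXn symmx_horner.
apply/eqP; rewrite -trmx_eq0 sT; apply/eqP.
apply/matrixP => i j'; rewrite [RHS]mxE.
suff : T *m delta_mx j' 0 = 0 :> 'cV_n.+1.
  move/matrixP/(_ i 0); rewrite mxE (bigD1 j') //= !mxE !eqxx mulr1 big1 ?addr0//.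
  by move=> h /negPf hj; rewrite !mxE hj mulr0.
by apply: bform1_eq0; rewrite bform_mull bform_mulr mulmx1 sT [T *m T]KK0 /bform
  mulmx0 mul0mx mxE.
Qed.

(** Newton interpolation: a new node is handled by adding a multiple of the product [r] that
    vanishes at the earlier ones. *)
Lemma poly_interpolation {F : fieldType} (s : seq F) (f : F -> F) :
  uniq s -> {q : {poly F} | {in s, forall a, q.[a] = f a}}.
Proof.
elim: s => [|a s IHs] /=; first by exists 0.
case/andP=> as_ /IHs[q qE]; pose r := \prod_(b <- s) ('X - b%:P).
have ra : r.[a] != 0 by move: as_; rewrite -root_prod_XsubC.
exists (q + ((f a - q.[a]) / r.[a])%:P * r) => b.
rewrite inE hornerD hornerM hornerC; case: eqP => [->|_ /= bs].
  by rewrite divfK // addrC subrK.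
by rewrite (_ : r.[b] = 0) ?mulr0 ?addr0 ?qE //; apply/eqP; rewrite -[_ == _]/(root r b) root_prod_XsubC.
Qed.

(** Every root of the split [char_poly K] is a root of [p - q], so [char_poly K] divides a power of
    [p - q]. By Cayley-Hamilton the symmetric matrix [(p - q)(K)] is nilpotent, hence zero. *)
Lemma symmx_horner_eq {R : realType} {n} (K : 'M[R]_n.+1) (p q : {poly R}) :
  K^T = K -> (forall a, eigenvalue K a -> p.[a] = q.[a]) ->
  horner_mx K p = horner_mx K q.
Proof.
move=> sK pq; apply/eqP; rewrite -subr_eq0 -rmorphB; apply/eqP.
have [s sE] := symmx_char_poly_split K sK.
apply: (symmx_expn_eq0 _ (size s)); first exact: symmx_horner.
rewrite -rmorphXn; suff /dvdpP[u ->] : char_poly K %| (p - q) ^+ size s.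
  by rewrite rmorphM /= Cayley_Hamilton mulr0.
have : all (root (p - q)) s.
  apply/allP => a sa; rewrite rootE hornerD hornerN pq ?subrr //.
  by rewrite eigenvalue_root_char sE root_prod_XsubC.
rewrite sE; elim: {sE} s => [|a s IHs] /=; first by rewrite big_nil dvd1p.
by case/andP=> ra rs; rewrite big_cons exprS dvdp_mul ?IHs // dvdp_XsubCl.
Qed.

(* The square root is sought as a polynomial in [K]; being itself a square, it
   is automatically positive semidefinite. *)
Lemma symmx_sqrt {R : realType} {n} (K : 'M[R]_n.+1) :
  K^T = K -> (forall a, eigenvalue K a -> 0 <= a) ->
  exists S : 'M[R]_n.+1, sympsd S /\ S *m S = K.
Proof.
move=> sK pK; have [s sE] := symmx_char_poly_split K sK.
(* Fourth roots are interpolated, because the square root of [K] will be [T *m T]. *)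
have [q qE] := poly_interpolation (undup s) (fun a => Num.sqrt (Num.sqrt a)) (undup_uniq s).
pose T := horner_mx K q; have sT : T^T = T by apply: symmx_horner.
exists (T *m T); split.
  split=> [|x]; first by rewrite trmx_mul sT.
  have := bform1_ge0 (T *m x).
  by rewrite bform_mull bform_mulr mulmx1 sT.
transitivity (horner_mx K (q ^+ 4)); first by rewrite rmorphXn /= (exprM _ 2 2) !expr2.
rewrite -[RHS]horner_mx_X; apply: symmx_horner_eq => // a aK.
rewrite hornerX horner_exp qE; last first.
  by rewrite mem_undup -root_prod_XsubC -sE -eigenvalue_root_char.
by rewrite (exprM _ 2 2) !sqr_sqrtr ?sqrtr_ge0 ?pK.
Qed.

Lemma sympsd_eigenvalue_ge0 {R : realType} {n} (K : 'M[R]_n) a :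
  sympsd K -> eigenvalue K a -> 0 <= a.
Proof.
move=> pK /eigenvalueP[v vK v0]; have := sympsd_bform_ge0 v^T pK.
rewrite /bform trmxK vK -scalemxAl mxE.
have : 0 < bform 1%:M v^T v^T by rewrite bform1_gt0 // trmx_eq0.
by rewrite /bform trmxK mulmx1 => p0; rewrite pmulr_lge0.
Qed.

Lemma sqrtmxP {R : realType} {n} (K : 'M[R]_n.+1) :
  sympsd K -> sympsd (sqrtmx K) /\ sqrtmx K *m sqrtmx K = K.
Proof.
move=> pK; have := symmx_sqrt K (proj1 pK) (fun a => sympsd_eigenvalue_ge0 K a pK).
by move/(xgetPex 0).
Qed.

(** The eigenvalues of [c - K] are nonnegative, so [c - K = S S] with [S] symmetric, and its form at
    [x] is [|S x|^2]. *)
Lemma symmx_rayleigh_le {R : realType} {n} (K : 'M[R]_n.+1) c x : K^T = K ->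
  (forall a, eigenvalue K a -> a <= c) -> bform K x x <= c * bform 1%:M x x.
Proof.
move=> sK Kc; have /symmx_sqrt[|S [pS SE]] : (c%:M - K)^T = c%:M - K.
- by rewrite linearB /= tr_scalar_mx sK.
- move=> a /eigenvalueP[v vE v0]; suff: c - a <= c by rewrite gerBl.
  apply: Kc; apply/eigenvalueP; exists v => //.
  by rewrite scalerBl -vE mulmxBr mul_mx_scalar opprB addrC subrK.
have := bform1_ge0 (S *m x); rewrite bform_mull bform_mulr mulmx1 (proj1 pS) SE.
by rewrite bformDm -(scalemx1 _ c) bformZm -scaleN1r bformZm mulN1r subr_ge0.
Qed.

(** * Extremal eigenvalues and the spectral norm *)

Section SpectralBounds.
Context {R : realType} {n : nat}.
Implicit Types (B : 'M[R]_n.+1) (x : 'cV[R]_n.+1) (a c : R).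

Lemma eigenvalue_bounded B : exists c, forall a, eigenvalue B a -> `|a| <= c.
Proof.
exists (cauchy_bound (char_poly B)) => a; rewrite eigenvalue_root_char => /rootP Ba.
by apply/ltW/(cauchy_boundP _ Ba)/monic_neq0/char_poly_monic.
Qed.

Lemma lambda_max_ge B a : eigenvalue B a -> a <= lambda_max B.
Proof.
have [c Bc] := eigenvalue_bounded B; move: a; apply: ub_le_sup.
by exists c => a /Bc; apply: le_trans; apply: ler_norm.
Qed.

Lemma lambda_min_le B a : eigenvalue B a -> lambda_min B <= a.
Proof.
have [c Bc] := eigenvalue_bounded B; move: a; apply: ge_inf.
by exists (- c) => a /Bc; rewrite ler_norml => /andP[].
Qed.

Lemma bform_unit : bform 1%:M (delta_mx 0 0) (delta_mx 0 0 : 'cV[R]_n.+1) = 1.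
Proof.
rewrite bform1E (bigD1 0) //= !mxE !eqxx expr1n big1 ?addr0 // => i /negPf i0.
by rewrite !mxE i0 expr0n.
Qed.

(** Without eigenvalues, the Rayleigh bound would hold vacuously for every constant, even one below
    the value of the form at a unit vector. *)
Lemma symmx_has_eigenvalue B : B^T = B -> exists a, eigenvalue B a.
Proof.
move=> sB; apply: contrapT => noB; pose e : 'cV[R]_n.+1 := delta_mx 0 0.
have /(_ (fun a Ba => False_ind _ (noB (ex_intro _ a Ba)))) :=
  symmx_rayleigh_le B (bform B e e - 1) e sB.
by rewrite bform_unit mulr1 lerBrDr gerDl ler10.
Qed.

Lemma euclid_norm_mulmx_le B x :
  euclid_norm (B *m x) <= spectral_norm B * euclid_norm x.
Proof.
have [->|x0] := eqVneq x 0.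
  by rewrite mulmx0 !euclid_normE /bform mulmx0 !mxE sqrtr0 mulr0.
have nx0 : 0 < euclid_norm x by rewrite euclid_normE sqrtr_gt0 bform1_gt0.
rewrite -ler_pdivrMr //; apply: ub_le_sup.
  (* The supremum is over a bounded set: [|B y|^2] is the form of [B^T B], controlled by its
     eigenvalues. *)
  have [c Kc] := eigenvalue_bounded (B^T *m B).
  exists (Num.sqrt c) => _ [y /= y1 <-]; rewrite euclid_normE ler_wsqrtr //.
  rewrite bform_mull bform_mulr mulmx1.
  have : euclid_norm y ^+ 2 = 1 by rewrite y1 expr1n.
  rewrite euclid_normE sqr_sqrtr ?bform1_ge0 // => {}y1.
  rewrite -[c]mulr1 -y1; apply: symmx_rayleigh_le; first by rewrite trmx_mul trmxK.
  by move=> a /Kc; apply: le_trans; apply: ler_norm.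
exists ((euclid_norm x)^-1 *: x).
  rewrite /= euclid_normE bformZl bformZr -[bform _ _ _]sqr_sqrtr ?bform1_ge0 //.
  by rewrite -euclid_normE mulrA -expr2 -exprMn mulVf ?gt_eqF // expr1n sqrtr1.
rewrite -scalemxAr !euclid_normE bformZl bformZr mulrA -expr2.
rewrite sqrtrM ?sqr_ge0 // sqrtr_sqr ger0_norm ?invr_ge0 ?sqrtr_ge0 //.
by rewrite mulrC.
Qed.

Lemma spectral_norm_ge0 B : 0 <= spectral_norm B.
Proof.
have := euclid_norm_mulmx_le B (delta_mx 0 0).
rewrite [X in _ * X]euclid_normE bform_unit sqrtr1 mulr1.
by apply: le_trans; rewrite euclid_normE sqrtr_ge0.
Qed.

Lemma bform_le_spectral_norm B x : bform B x x <= spectral_norm B * bform 1%:M x x.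
Proof.
have := bform_CauchySchwarz x (B *m x) sympsd1.
have := euclid_norm_mulmx_le B x; have := spectral_norm_ge0 B.
rewrite (_ : bform 1%:M x (B *m x) = bform B x x); last by rewrite bform_mulr mul1mx.
rewrite !euclid_normE.
move: (spectral_norm B) => e e0 le1 CS.
have p := bform1_ge0 x; have q := bform1_ge0 (B *m x).
have : bform 1%:M (B *m x) (B *m x) <= e ^+ 2 * bform 1%:M x x.
  by rewrite -(sqr_sqrtr p) -(sqr_sqrtr q) -exprMn lerXn2r // nnegrE ?mulr_ge0 ?sqrtr_ge0.
move: CS {le1}; move: p q (mulr_ge0 e0 p).
move: (bform B x x) (bform _ x x) (bform _ (B *m x) _) => b p q p0 q0 ep0 CS qe.
rewrite -[leRHS]ger0_norm // (le_trans (ler_norm _)) // -ler_sqr ?nnegrE ?normr_ge0 //.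
rewrite !real_normK ?num_real //; nra.
Qed.

(** For a unit vector [x], Cauchy-Schwarz for [B] between [x] and [B x] gives
    [|B x|^4 <= c * (c |B x|^2)]. *)
Lemma spectral_norm_sympsd_le B c : sympsd B -> 0 <= c ->
  (forall x, bform B x x <= c * bform 1%:M x x) -> spectral_norm B <= c.
Proof.
move=> pB c0 Bc; apply: ge_sup.
  exists (euclid_norm (B *m delta_mx 0 0)); exists (delta_mx 0 0) => //=.
  by rewrite euclid_normE bform_unit sqrtr1.
move=> _ [x /= x1 <-]; have {}x1 : bform 1%:M x x = 1.
  by rewrite -[LHS]sqr_sqrtr ?bform1_ge0 // -euclid_normE x1 expr1n.
rewrite euclid_normE -[c]ger0_norm // -sqrtr_sqr ler_wsqrtr //.
have := bform_CauchySchwarz x (B *m x) pB.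
rewrite (_ : bform B x (B *m x) = bform 1%:M (B *m x) (B *m x)); last first.
  by rewrite [RHS]bform_mull [RHS]bform_mulr mulmx1 (proj1 pB) bform_mulr.
have := Bc x; have := Bc (B *m x); rewrite x1.
have := sympsd_bform_ge0 (B *m x) pB; have := sympsd_bform_ge0 x pB.
have := bform1_ge0 (B *m x).
move: (bform _ _ _) (bform B x x) (bform B _ _) => q b d q0 b0 d0 dq bc CS.
have [->|qn0] := eqVneq q 0; first exact: sqr_ge0.
have qp : 0 < q by rewrite lt_def qn0.
rewrite -(ler_pM2r qp) -expr2 (le_trans CS) //.
have -> : c ^+ 2 * q = (c * 1) * (c * q) by rewrite mulr1 mulrA.
exact: ler_pM.
Qed.

End SpectralBounds.

(** * The inverse of a positive definite matrix *)

Section InversePositiveDefinite.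
Context {R : realType} {n : nat} (A : 'M[R]_n.+1) (pA : sympd A).

Let iA := invmx A.
Let m := lambda_min A.

Let sA : A^T = A. Proof. by case: pA. Qed.
Let siA : iA^T = iA. Proof. by rewrite trmx_inv sA. Qed.
Let AiA : A *m iA = 1%:M. Proof. by rewrite mulmxV // sympd_unitmx. Qed.
Let iAA : iA *m A = 1%:M. Proof. by rewrite mulVmx // sympd_unitmx. Qed.

Lemma bform_invmx (x : 'cV_n.+1) : bform iA x x = bform A (iA *m x) (iA *m x).
Proof. by rewrite bform_mull bform_mulr siA iAA mul1mx. Qed.

Lemma bform_mulmx_invmx (x : 'cV_n.+1) : bform iA (A *m x) (A *m x) = bform A x x.
Proof. by rewrite bform_mull bform_mulr sA AiA mul1mx. Qed.

Lemma sympd_invmx : sympd iA.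
Proof.
split=> // x x0; have := bform_invmx x; rewrite {1}/bform => ->.
apply: sympd_bform_gt0 => //; apply: contra_neq x0 => iAx.
by rewrite -[x]mul1mx -AiA -mulmxA iAx mulmx0.
Qed.

Let piA : sympsd iA. Proof. exact/sympd_sympsd/sympd_invmx. Qed.

(** Inverses of eigenvalues of [A] are eigenvalues of [iA], hence at most some [c]; the infimum is
    therefore at least [c^-1]. *)
Lemma sympd_lambda_min_gt0 : 0 < m.
Proof.
have [c Kc] := eigenvalue_bounded iA.
have [a Aa] := symmx_has_eigenvalue A sA.
have pos b : eigenvalue A b -> 0 < b /\ eigenvalue iA b^-1.
  move=> /eigenvalueP[v vA v0].
  have b0 : b != 0.
    apply: contra_neq v0 => b0; rewrite b0 scale0r in vA.
    by rewrite -[v]mulmx1 -AiA mulmxA vA mul0mx.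
  split.
    rewrite lt_def b0 /=; apply: (sympsd_eigenvalue_ge0 A); first exact: sympd_sympsd.
    by apply/eigenvalueP; exists v.
  apply/eigenvalueP; exists v => //; apply: (scalerI b0).
  by rewrite scalerA divff // scale1r scalemxAl -vA -mulmxA AiA mulmx1.
have [a0 /Kc ac] := pos _ Aa.
have c0 : 0 < c by apply: lt_le_trans ac; rewrite normr_gt0 invr_neq0 // gt_eqF.
suff : c^-1 <= m by apply: lt_le_trans; rewrite invr_gt0.
apply: lb_le_inf; first by exists a.
move=> b /pos[b0 /Kc]; rewrite ger0_norm ?invr_ge0 ?(ltW b0) // => bc.
by rewrite -[b]invrK lef_pV2 ?posrE ?invr_gt0.
Qed.

Lemma bform_invmx_le x : bform iA x x <= m^-1 * bform 1%:M x x.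
Proof.
apply: symmx_rayleigh_le => // a aiA.
have a0 : 0 < a.
  have := aiA => /eigenvalueP[v vA v0].
  rewrite lt_def (sympsd_eigenvalue_ge0 iA) // andbT.
  apply: contra_neq v0 => a0; rewrite a0 scale0r in vA.
  by rewrite -[v]mulmx1 -iAA mulmxA vA mul0mx.
rewrite -[a]invrK lef_pV2 ?posrE ?invr_gt0 ?sympd_lambda_min_gt0 //.
apply: lambda_min_le; have /eigenvalueP[v vA v0] := aiA.
apply/eigenvalueP; exists v => //; apply: (scalerI (lt0r_neq0 a0)).
by rewrite scalerA divff ?gt_eqF // scale1r scalemxAl -vA -mulmxA iAA mulmx1.
Qed.

End InversePositiveDefinite.

(** * The preconditioner *)

Lemma idem_fixed_vector {R : fieldType} {n} (Q : 'M[R]_n) : Q *m Q = Q -> Q != 0 ->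
  exists2 x : 'cV[R]_n, x != 0 & Q *m x = x.
Proof.
move=> QQ Q0; have /matrix0Pn[i [j Qij]] := Q0.
exists (col j Q); last by rewrite colE mulmxA QQ.
by apply: contra_neq Qij => /matrixP/(_ i 0); rewrite !mxE.
Qed.

Section ProjectedPreconditioner.
Context {R : realType} {n : nat}.
Context (A Pi : 'M[R]_n.+1) (rho : R).
Context (pA : sympd A) (sPi : Pi^T = Pi) (PiPi : Pi *m Pi = Pi).
Context (Pi0 : Pi != 0) (Pi1 : Pi != 1%:M) (rho0 : 0 < rho).

Let iA := invmx A.
Let Pc := 1%:M - Pi.
Let E := Pc *m A *m Pc.
Let F := Pc *m iA *m Pc.
Let H := Pi *m iA *m Pi.
Let G := Pi *m A *m Pi *m iA *m Pi.
Let g := lambda_max G.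
Let e := spectral_norm E.
Let f := spectral_norm F.
Let m := lambda_min A.

Let sA : A^T = A. Proof. by case: pA. Qed.
Let siA : iA^T = iA. Proof. by rewrite trmx_inv sA. Qed.
Let AiA : A *m iA = 1%:M. Proof. by rewrite mulmxV // sympd_unitmx. Qed.
Let iAA : iA *m A = 1%:M. Proof. by rewrite mulVmx // sympd_unitmx. Qed.
Let sPc : Pc^T = Pc. Proof. by rewrite linearB /= trmx1 sPi. Qed.
Let PcPc : Pc *m Pc = Pc.
Proof. by rewrite mulmxBl mul1mx mulmxBr mulmx1 PiPi subrr subr0. Qed.
Let PcDPi x : x = Pc *m x + Pi *m x :> 'cV_n.+1.
Proof. by rewrite -mulmxDl subrK mul1mx. Qed.

Let piA : sympsd iA. Proof. exact: sympd_sympsd (sympd_invmx _ pA). Qed.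

Let bformE x : bform E x x = bform A (Pc *m x) (Pc *m x).
Proof. exact: bform_symconj. Qed.

Let bformF x : bform F x x = bform iA (Pc *m x) (Pc *m x).
Proof. exact: bform_symconj. Qed.

Let bformH x : bform H x x = bform iA (Pi *m x) (Pi *m x).
Proof. exact: bform_symconj. Qed.

Let sympsdF : sympsd F.
Proof. by rewrite /F -{1}sPc; apply: sympsd_conj. Qed.

(** As [Pi] is not the identity, [Pc] fixes some nonzero [x], at which the form of [E] is that of
    [A]. *)
Lemma deflated_norm_gt0 : 0 < e.
Proof.
have Pc0 : Pc != 0 by rewrite subr_eq0 eq_sym.
have [x x0 Px] := idem_fixed_vector Pc PcPc Pc0.
have := bform_le_spectral_norm E x; rewrite bformE Px -/e.
have := sympd_bform_gt0 x pA x0; have := bform1_gt0 x x0; nra.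
Qed.

(* The nonzero eigenvalues of [G] are those of the symmetric matrix
   [A^(1/2) Pi A^-1 Pi A^(1/2)]. *)
Lemma projected_invmx_le_max0 y : bform H y y <= Num.max 0 g * bform iA y y.
Proof.
have [[sS pS] SS] := sqrtmxP A (sympd_sympsd pA); set S := sqrtmx A in sS SS.
pose z := S *m (iA *m y).
have Sz : S *m z = y by rewrite /z !mulmxA SS AiA mul1mx.
have -> : bform H y y = bform (S *m H *m S) z z.
  by rewrite -[S in S *m H]sS -bform_mulr -bform_mull Sz.
have -> : bform iA y y = bform 1%:M z z.
  by rewrite (bform_invmx _ pA) /z [RHS]bform_mull bform_mulr mulmx1 sS SS.
apply: symmx_rayleigh_le => [|a /eigenvalueP[v vK v0]].
  by rewrite !trmx_mul sS sPi siA !mulmxA.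
rewrite le_max; have [//|a0] := leP a 0; apply/orP; right.
apply: lambda_max_ge; apply/eigenvalueP; exists (v *m S *m H).
  have -> : G = Pi *m A *m H by rewrite /G /H !mulmxA.
  have -> : v *m S *m H *m (Pi *m A *m H) = v *m (S *m H *m S) *m S *m H.
    by rewrite -!mulmxA [S *m (S *m _)]mulmxA SS /H -!mulmxA [Pi *m (Pi *m _)]mulmxA PiPi.
  by rewrite vK -!scalemxAl.
apply: contra_neq v0 => vSH0; apply: (scalerI (lt0r_neq0 a0)).
by rewrite scaler0 -vK (mulmxA v) (mulmxA v) vSH0 mul0mx.
Qed.

(** At a nonzero vector fixed by [Pi] the forms of [H] and [iA] agree, so [1 <= Num.max 0 g]. This
    also removes the maximum with 0 from the previous bound. *)
Lemma projected_lambda_max_ge1 : 1 <= g.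
Proof.
have [x x0 Px] := idem_fixed_vector Pi PiPi Pi0.
have := projected_invmx_le_max0 x; rewrite bformH Px.
rewrite -[X in X <= _]mul1r ler_pM2r; last exact: sympd_bform_gt0 (sympd_invmx _ pA) x0.
by rewrite le_max ler10.
Qed.

Lemma projected_invmx_le y : bform H y y <= g * bform iA y y.
Proof.
have := projected_invmx_le_max0 y; rewrite max_r //; exact: le_trans projected_lambda_max_ge1.
Qed.

(** Cauchy-Schwarz for [A] between [Pc y] and [iA y] bounds [|Pc y|^4] by the forms of [E] at [Pc y]
    and of [iA] at [y]. The former is at most [e |Pc y|^2], and one factor [|Pc y|^2] cancels. *)
Lemma projector_compl_le y : bform 1%:M (Pc *m y) (Pc *m y) <= e * bform iA y y.
Proof.
have := bform_CauchySchwarz (Pc *m y) (iA *m y) (sympd_sympsd pA).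
have -> : bform A (Pc *m y) (iA *m y) = bform 1%:M (Pc *m y) (Pc *m y).
  by rewrite [LHS]bform_mulr AiA [RHS]bform_mulr mul1mx bform_mull bform_mull sPc mulmx1 PcPc.
rewrite -(bform_invmx _ pA) -[bform A _ _](_ : bform E (Pc *m y) (Pc *m y) = _); last first.
  by rewrite bformE mulmxA PcPc.
have := bform_le_spectral_norm E (Pc *m y); rewrite -/e.
have := bform1_ge0 (Pc *m y); have := sympsd_bform_ge0 y piA; have := deflated_norm_gt0.
move: (bform _ _ _) (bform E _ _) (bform iA _ _) => q b d e0 d0 q0 bq CS.
have [->|qn0] := eqVneq q 0; first by rewrite mulr_ge0 // ltW.
have qp : 0 < q by rewrite lt_def qn0.
by rewrite -(ler_pM2l qp) -expr2 (le_trans CS) // mulrA [q * e]mulrC ler_wpM2r.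
Qed.

Lemma deflated_invmx_norm_le : f <= m^-1.
Proof.
apply: spectral_norm_sympsd_le sympsdF _ _ => [|x].
  by rewrite invr_ge0 ltW // (sympd_lambda_min_gt0 _ pA).
rewrite bformF (le_trans (bform_invmx_le _ pA _)) // ler_wpM2l //.
  by rewrite invr_ge0 ltW // (sympd_lambda_min_gt0 _ pA).
have : bform 1%:M x x = bform 1%:M (Pc *m x) (Pc *m x) + bform 1%:M (Pi *m x) (Pi *m x).
  rewrite !bform_mull !bform_mulr !mulmx1 sPc sPi PcPc PiPi -bformDm.
  by rewrite subrK.
by move->; rewrite lerDl bform1_ge0.
Qed.

Lemma lambda_max_le_sqr : g <= (1 + Num.sqrt e / Num.sqrt m) ^+ 2.
Proof.
have e0 := deflated_norm_gt0; have m0 := (sympd_lambda_min_gt0 _ pA).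
set k := Num.sqrt e / Num.sqrt m.
have k0 : 0 <= k by rewrite divr_ge0 ?sqrtr_ge0.
have k2 : k ^+ 2 = e / m by rewrite expr_div_n !sqr_sqrtr // ltW.
suff Gk a : eigenvalue G a -> a <= (1 + k) ^+ 2.
  (* An empty spectrum would give [g] the default value 0, against [1 <= g]. *)
  have [G0|/set0P G0] := eqVneq [set a | eigenvalue G a]%classic set0.
    by have := projected_lambda_max_ge1; rewrite /g /lambda_max G0 sup0 ler10.
  by apply: ge_sup => // a; apply: Gk.
move=> /eigenvalueP[v vG v0].
have [a0|a0] := leP a 0; first exact: le_trans a0 (sqr_ge0 _).
have vPi : v *m Pi = v.
  apply: (scalerI (lt0r_neq0 a0)); rewrite scalemxAl -vG /G.
  by rewrite -!mulmxA PiPi.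
(* With this [y], the form of [iA] is [v A v^T] at [y] and [a] times that at [Pi y]. *)
pose y := A *m v^T.
have N0 : 0 < bform iA y y.
  by rewrite (bform_mulmx_invmx _ pA) sympd_bform_gt0 // trmx_eq0.
have vAH : v *m A *m H = a *: v by rewrite -vG /G /H -[in LHS]vPi !mulmxA.
have yE : bform iA (Pi *m y) (Pi *m y) = a * bform iA y y.
  rewrite -bformH (bform_mulmx_invmx _ pA) /bform trmxK trmx_mul trmxK sA vAH.
  by rewrite -!scalemxAl mxE mulmxA.
have Pcy : bform iA (Pc *m y) (Pc *m y) <= k ^+ 2 * bform iA y y.
  rewrite (le_trans (bform_invmx_le _ pA _)) // k2 [e / m]mulrC -mulrA.
  by rewrite ler_wpM2l ?projector_compl_le // invr_ge0 ltW.
have CS := bform_CauchySchwarz y (Pc *m y) piA.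
have : bform iA (Pi *m y) (Pi *m y) =
    bform iA y y - 2 * bform iA y (Pc *m y) + bform iA (Pc *m y) (Pc *m y).
  have -> : Pi *m y = y + (-1) *: (Pc *m y).
    by rewrite scaleN1r {2}(PcDPi y) addrC addKr.
  rewrite !(bformDl, bformDr, bformZl, bformZr) (bformC (Pc *m y) y siA); ring.
rewrite yE; have := sympsd_bform_ge0 (Pc *m y) piA.
move: N0 Pcy CS; move: (bform iA y y) (bform iA y (Pc *m y)) (bform iA (Pc *m y) _) => N b q N0 qk CS q0 aN.
have bN : `|b| <= k * N.
  have kN0 : 0 <= k * N. by exact: mulr_ge0 k0 (ltW N0).
  rewrite -ler_sqr ?nnegrE // real_normK ?num_real //.
  by rewrite (le_trans CS) // exprMn expr2 mulrA mulrC ler_wpM2r ?(ltW N0) // mulrC.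
have := ler_norm (- b); rewrite normrN => bN'.
(* Here [a N = N - 2 b + q <= N + 2 k N + k^2 N]. *)
by rewrite -(ler_pM2r N0) aN; nra.
Qed.

(** * The preconditioned operator for the prescribed scaling *)

Section Scaling.
Context (tau : R) (tauE : tau = rho * e * g^-1).

Let P := Pc + tau *: H.

Let tau0 : 0 < tau.
Proof.
by rewrite tauE !mulr_gt0 ?deflated_norm_gt0 // invr_gt0 (lt_le_trans ltr01) // projected_lambda_max_ge1.
Qed.

Lemma preconditioner_bformE x :
  bform P x x = bform 1%:M (Pc *m x) (Pc *m x) + tau * bform iA (Pi *m x) (Pi *m x).
Proof.
rewrite bformDm bformZm bformH; congr (_ + _).
by rewrite bform_mull bform_mulr mulmx1 sPc PcPc.
Qed.

Lemma sympd_preconditioner : sympd P.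
Proof.
split; first by rewrite linearD linearZ /= sPc /H !trmx_mul sPi siA mulmxA.
move=> x x0; have := preconditioner_bformE x; rewrite {1}/bform => ->.
have [Pix0|Pix0] := eqVneq (Pi *m x) 0.
  rewrite ltr_wpDr ?bform1_gt0 //.
    by rewrite mulr_ge0 ?(ltW tau0) // sympsd_bform_ge0.
  by move: x0; rewrite {1}(PcDPi x) Pix0 addr0.
by rewrite ltr_wpDl ?bform1_ge0 // mulr_gt0 // sympd_bform_gt0 //; apply: (sympd_invmx _ pA).
Qed.

(** The value of [tau] is such that [tau * g = rho * e]: the two terms of [P] contribute [e] and
    [rho * e]. *)
Lemma preconditioner_le x : bform P x x <= (1 + rho) * e * bform iA x x.
Proof.
have g0 : 0 < g by rewrite (lt_le_trans ltr01) // projected_lambda_max_ge1.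
rewrite preconditioner_bformE -bformH -[leRHS]mulrA mulrDl mul1r lerD ?projector_compl_le //.
have -> : rho * (e * bform iA x x) = tau * (g * bform iA x x).
  by rewrite tauE; field; rewrite gt_eqF.
by rewrite ler_wpM2l ?(ltW tau0) // projected_invmx_le.
Qed.

(* The triangle inequality for the norm of [A^-1] applied to
   [x = Pc x + Pi x]. *)
Lemma preconditioner_ge x : bform iA x x <= (f + tau^-1) * bform P x x.
Proof.
have -> : bform iA x x = bform iA (Pc *m x) (Pc *m x) +
    2 * bform iA (Pc *m x) (Pi *m x) + bform iA (Pi *m x) (Pi *m x).
  rewrite {1 2}(PcDPi x) !(bformDl, bformDr) (bformC (Pi *m x) _ siA); ring.
have f0 : 0 <= f := spectral_norm_ge0 F.
have uf : bform iA (Pc *m x) (Pc *m x) <= f * bform 1%:M (Pc *m x) (Pc *m x).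
  by have := bform_le_spectral_norm F (Pc *m x); rewrite bformF mulmxA PcPc.
have CS := bform_CauchySchwarz (Pc *m x) (Pi *m x) piA.
rewrite preconditioner_bformE; move: uf CS.
have := bform1_ge0 (Pc *m x); have := sympsd_bform_ge0 (Pc *m x) piA.
have := sympsd_bform_ge0 (Pi *m x) piA.
move: (bform 1%:M _ _) (bform iA _ (Pc *m x)) (bform iA (Pi *m x) _) (bform iA (Pc *m x) (Pi *m x)).
move=> p u w b w0 u0 p0 up CS; have t0 := tau0.
have -> : (f + tau^-1) * (p + tau * w) = f * p + (f * tau * w + p / tau) + w.
  by field; rewrite gt_eqF.
rewrite lerD2r lerD //.
have X0 : 0 <= f * tau * w + p / tau.
  by rewrite addr_ge0 ?mulr_ge0 ?invr_ge0 // ltW.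
rewrite (le_trans (ler_norm _)) // -ler_sqr ?nnegrE // real_normK ?num_real //.
(* Arithmetic-geometric mean: the two mixed terms have a product that is at least [u * w >= b^2], so
   their sum is at least [2 * b]. *)
have : (f * tau * w) * (p / tau) = (f * p) * w by field; rewrite gt_eqF.
have : u * w <= f * p * w by rewrite ler_wpM2r.
move: (f * tau * w) (p / tau) (f * p * w) (u * w) CS {X0} => X Y Z V CS VZ XY.
have := sqr_ge0 (X - Y); nra.
Qed.

Let S := sqrtmx P.
Let B := S *m A *m S.

Let sS : S^T = S.
Proof. by have [[]] := sqrtmxP P (sympd_sympsd sympd_preconditioner). Qed.

Let SS : S *m S = P.
Proof. by have [] := sqrtmxP P (sympd_sympsd sympd_preconditioner). Qed.

Lemma sympd_preconditioned : sympd B.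
Proof.
split; first by rewrite !trmx_mul sS sA mulmxA.
move=> x x0; have -> : (x^T *m B *m x) 0 0 = bform A (S *m x) (S *m x).
  by rewrite bform_mull bform_mulr sS.
apply: sympd_bform_gt0 => //; apply: contra_neq x0 => Sx0.
apply: (can_inj (mulKmx (sympd_unitmx sympd_preconditioner))).
by rewrite -SS -mulmxA Sx0 !mulmx0.
Qed.

(** The row [w = v S] satisfies [w A P = a w], and [y = A w^T] turns this into an equality of
    quadratic forms. *)
Lemma preconditioned_eigenvalue_rayleigh a : eigenvalue B a ->
  exists2 y, 0 < bform iA y y & bform P y y = a * bform iA y y.
Proof.
move=> /eigenvalueP[v vB v0]; pose w := v *m S.
have wAP : w *m A *m P = a *: w.
  by rewrite scalemxAl -vB -SS /w /B !mulmxA.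
have w0 : w != 0.
  apply: contra_neq v0 => w0; apply: (can_inj (mulmxK (sympd_unitmx sympd_preconditioner))).
  by rewrite -SS mulmxA -/w w0 !mul0mx.
exists (A *m w^T); first by rewrite (bform_mulmx_invmx _ pA) sympd_bform_gt0 // trmx_eq0.
rewrite (bform_mulmx_invmx _ pA) /bform trmxK trmx_mul trmxK sA wAP.
by rewrite -!scalemxAl mxE mulmxA.
Qed.

Lemma preconditioned_eigenvalue_bounds a : eigenvalue B a ->
  (f + tau^-1)^-1 <= a /\ a <= (1 + rho) * e.
Proof.
move=> /preconditioned_eigenvalue_rayleigh[y y0 yE].
have fpos : 0 < f + tau^-1 by rewrite ltr_wpDl ?spectral_norm_ge0 ?invr_gt0.
split; last by rewrite -(ler_pM2r y0) -yE preconditioner_le.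
by rewrite -div1r ler_pdivrMr // mulrC -(ler_pM2r y0) mul1r -mulrA -yE preconditioner_ge.
Qed.

Let ft0 : 0 < f + tau^-1.
Proof. by rewrite ltr_wpDl ?spectral_norm_ge0 ?invr_gt0. Qed.

(** From [v B B = s^2 v], the row [u = v B + s v] satisfies [u B = s u]. If [u = 0], then [- s <= 0]
    would be an eigenvalue, against the positive lower bound. *)
Lemma preconditioned_singular_value s : singular_value B s -> eigenvalue B s.
Proof.
move=> [s0 /eigenvalueP[v vBB v0]]; have [sB _] := sympd_preconditioned.
rewrite sB mulmxA in vBB; pose u := v *m B + s *: v.
have uB : u *m B = s *: u.
  by rewrite mulmxDl vBB -scalemxAl scalerDr scalerA -expr2 addrC.
have [u0|u0] := eqVneq u 0; last by apply/eigenvalueP; exists u.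
have /preconditioned_eigenvalue_bounds[] : eigenvalue B (- s).
  by apply/eigenvalueP; exists v => //; apply/eqP; rewrite scaleNr -addr_eq0; apply/eqP.
by rewrite leNgt (le_lt_trans _ (_ : 0 < _)) ?invr_gt0 ?oppr_le0.
Qed.

Lemma preconditioned_cond_le_bounds : cond B <= (1 + rho) * e * (f + tau^-1).
Proof.
have M0 : 0 <= (1 + rho) * e by rewrite mulr_ge0 ?addr_ge0 ?ltW ?deflated_norm_gt0.
(* With no singular value the supremum, and so the quotient, would be 0 by default. *)
rewrite /cond; have [->|/set0P B0] := eqVneq (singular_value B) set0.
  by rewrite sup0 mul0r mulr_ge0 // ltW.
have sup_le : sup (singular_value B) <= (1 + rho) * e.
  by apply: ge_sup => // s /preconditioned_singular_value/preconditioned_eigenvalue_bounds[].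
have inf_ge : (f + tau^-1)^-1 <= inf (singular_value B).
  by apply: lb_le_inf => // s /preconditioned_singular_value/preconditioned_eigenvalue_bounds[].
have i0 : 0 < inf (singular_value B) by apply: lt_le_trans inf_ge; rewrite invr_gt0.
rewrite (le_trans (_ : _ <= (1 + rho) * e / inf (singular_value B))) //.
  by rewrite ler_wpM2r // invr_ge0 ltW.
by rewrite ler_wpM2l // -[leRHS]invrK lef_pV2 ?posrE ?invr_gt0.
Qed.

Lemma preconditioned_cond_le : cond B <= (1 + rho) * (e / m) + (1 + rho^-1) * g.
Proof.
have e0 := deflated_norm_gt0; have g0 : 0 < g := lt_le_trans ltr01 projected_lambda_max_ge1.
rewrite (le_trans preconditioned_cond_le_bounds) //.
(* Since [e / tau = g / rho], the [tau] term is [(1 + rho) * g / rho]. *)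
have -> : (1 + rho) * e * (f + tau^-1) = (1 + rho) * (e * f) + (1 + rho^-1) * g.
  by rewrite tauE; field; rewrite !gt_eqF.
by rewrite lerD2r !ler_wpM2l ?addr_ge0 ?deflated_invmx_norm_le // ltW.
Qed.

End Scaling.
End ProjectedPreconditioner.

(** * Nontriviality of the projector, and the final assembly *)

Lemma orthogonal_projector_neq0 {R : realType} {n l} (Pi : 'M[R]_n) (M : 'M[R]_(n, l)) :
  orthogonal_projector_onto_range Pi M -> M != 0 -> Pi != 0.
Proof.
move=> [_ _ rPi]; apply: contra_neq => Pi0.
apply/eqP; rewrite -trmx_eq0 -mxrank_eq0 -rPi Pi0 trmx0 mxrank0.
by [].
Qed.

Lemma orthogonal_projector_neq1 {R : realType} {n l} (Pi : 'M[R]_n) (M : 'M[R]_(n, l)) :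
  orthogonal_projector_onto_range Pi M -> (l < n)%N -> Pi != 1%:M.
Proof.
move=> [_ _ rPi] ln; apply: contraTneq ln => Pi1.
by rewrite -leqNgt -{1}(mxrank1 R n) -{1}trmx1 -Pi1 rPi mxrank_tr rank_leq_col.
Qed.

Theorem proposition3p3 (R : realType) (n l : nat)
    (Amu : 'M[R]_n) (Omega : 'M[R]_(n, l)) (Pi : 'M[R]_n) (rho tau : R)
    (hA : sympd Amu) (hOmega : Omega != 0) (hl : (l < n)%N)
    (hPi : orthogonal_projector_onto_range Pi (Amu *m Omega))
    (hrho : 0 < rho) :
  let Pc := 1%:M - Pi in
  let P := Pc + tau *: (Pi *m invmx Amu *m Pi) in
  let E := Pc *m Amu *m Pc in
  let F := Pc *m invmx Amu *m Pc in
  let G := Pi *m Amu *m Pi *m invmx Amu *m Pi in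
  let B := sqrtmx P *m Amu *m sqrtmx P in
  tau = rho * spectral_norm E * (lambda_max G)^-1 ->
  (forall lam : R, eigenvalue B lam ->
     (spectral_norm F + tau^-1)^-1 <= lam /\
     lam <= (1 + rho) * spectral_norm E) /\
  (cond B <= (1 + rho) * (spectral_norm E / lambda_min Amu)
             + (1 + rho^-1) * lambda_max G /\
   (1 + rho) * (spectral_norm E / lambda_min Amu)
     + (1 + rho^-1) * lambda_max G
   <= (1 + rho) * (spectral_norm E / lambda_min Amu)
      + (1 + rho^-1) *
        (1 + Num.sqrt (spectral_norm E) / Num.sqrt (lambda_min Amu)) ^+ 2).
Proof.
have AO0 : Amu *m Omega != 0.
  apply: contra_neq hOmega => AO0.
  by apply: (can_inj (mulKmx (sympd_unitmx hA))); rewrite AO0 mulmx0.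
have Pi0 := orthogonal_projector_neq0 _ _ hPi AO0.
have Pi1 := orthogonal_projector_neq1 _ _ hPi hl.
case: hPi => sPi PiPi _ Pc P E F G B tauE.
(* Size 0 is excluded by [l < n]; the spectral results are stated for sizes [n.+1]. *)
case: n => [//|n] in Amu Omega Pi hA hOmega hl sPi PiPi Pc P E F G B tauE AO0 Pi0 Pi1 *.
split; first exact: preconditioned_eigenvalue_bounds.
split; first exact: preconditioned_cond_le.
rewrite lerD2l ler_wpM2l ?lambda_max_le_sqr //.
by rewrite addr_ge0 // invr_ge0 ltW.
Qed.
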